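(* Let $(Y,\mathbf{X})$ be a random vector with $Y$ real-valued and $\mathbf{X}$ taking values in $\mathbb{R}^p$, $p\in\mathbb{N}$. Let $U,V\sim U(0,1)$ be independent. Then the rearranged quantile transform $q_{Y;\mathbf{X}}^{\uparrow u}$ has the following properties: (i) $q_{Y;\mathbf{X}}^{\uparrow U}(V)\stackrel{d}{=}Y$; (ii) $(q_{Y;\mathbf{X}}^{\uparrow U}(V),U)$ is a bivariate SI (stochastically increasing) random vector; (iii) $(q_{Y;\mathbf{X}}^{\uparrow U}(V),U)=_{ccx}(Y,\mathbf{X})$.
   Context: For a distribution function $G$, $G^{-1}(v)=\inf\{y\mid G(y)\ge v\}$, $v\in(0,1)$; $F_Y$ is the distribution function of $Y$ and $q_Y=F_Y^{-1}$. $\stackrel{d}{=}$ is equality in distribution. Rearranged quantile transform: the multivariate quantile transform $\mathbf{q}_{\mathbf{X}}\colon(0,1)^p\to\mathbb{R}^p$ is $\mathbf{q}_{\mathbf{X}}(\mathbf{u})=(x_1,\ldots,x_p)$ with $x_1=F_{X_1}^{-1}(u_1)$ and iteratively $x_i=F^{-1}_{X_i|X_{i-1}=x_{i-1},\ldots,X_1=x_1}(u_i)$; thus $\mathbf{q}_{\mathbf{X}}(\mathbf{U})\stackrel{d}{=}\mathbf{X}$ for $\mathbf{U}$ uniform on $(0,1)^p$. The decreasing rearrangement of an integrable $h\colon(0,1)^k\to\mathbb{R}$ is the (Lebesgue-essentially unique) decreasing function $h^*\colon(0,1)\to\mathbb{R}$ with $\lambda(h^*\ge w)=\lambda^k(h\ge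 w)$ for all $w\in\mathbb{R}$. Let $(y,u)\mapsto F_u(y)$ be such that for every $y\in\mathbb{R}$ the map $u\mapsto F_u(y)$ is a decreasing rearrangement of $\mathbf{u}\mapsto P(Y\le y\mid\mathbf{X}=\mathbf{q}_{\mathbf{X}}(\mathbf{u}))$ and for every $u\in(0,1)$ the map $y\mapsto F_u(y)$ is a distribution function (such a version exists). Then $q_{Y;\mathbf{X}}^{\uparrow u}(t):=F_u^{-1}(t)$, $t\in(0,1)$. A bivariate random vector $(W_1,W_2)$ is SI if $W_1$ is stochastically increasing in $W_2$, i.e. $\mathbb{E}[f(W_1)\mid W_2=t]$ is (has a version that is) increasing in $t$ for all increasing $f$ such that the expectations exist. For bounded random variables, $S\le_{cx}T$ means $\mathbb{E}\varphi(S)\le\mathbb{E}\varphi(T)$ for all convex $\varphi\colon\mathbb{R}\to\mathbb{R}$. Conditional convex order: $(Y,\mathbf{X})\preccurlyeq_{ccx}(Y',\mathbf{X}')$ means $P(Y\ge q_Y(v)\mid\mathbf{X})\le_{cx}P(Y'\ge q_{Y'}(v)\mid\mathbf{X}')$ for all $v\in(0,1)$ (the dimensions of $\mathbf{X},\mathbf{X}'$ may differ); $=_{ccx}$ means both directions hold. *)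

(* Defs.v *)
From HB Require Import structures.
From mathcomp Require Import all_boot all_order all_algebra.
From mathcomp Require Import all_classical all_reals all_analysis.
From mathcomp Require Import measurable_realfun.

Set Implicit Arguments.
Unset Strict Implicit.
Unset Printing Implicit Defensive.
Import Order.TTheory GRing.Theory Num.Theory.
Import numFieldNormedType.Exports.
Local Open Scope classical_set_scope.
Local Open Scope ring_scope.

(* Distributions are compared on measurable sets only: the values of a
   [distribution] on the other sets carry no information. *)
Definition eq_dist d d' d1 (T : measurableType d) (T' : measurableType d')
    (S : measurableType d1) (R : realType)
    (P : probability T R) (X : {RV P >-> S})
    (P' : probability T' R) (X' : {RV P' >-> S}) :=
  forall B : set S, measurable B -> distribution P X B = distribution P' X' B.

Definition is_uniform01 d (T : measurableType d) (R : realType)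
    (P : probability T R) (U : {RV P >-> R}) :=
  forall B : set R, measurable B ->
    distribution P U B = uniform_prob (@ltr01 R) B.

Definition indep d (T : measurableType d) (R : realType)
    (P : probability T R) (U V : {RV P >-> R}) :=
  forall A B : set R, measurable A -> measurable B ->
    P (U @^-1` A `&` V @^-1` B) = (P (U @^-1` A) * P (V @^-1` B))%E.

(* The left-continuous generalized inverse G^{-1}; meaningful for 0 < v < 1. *)
Definition quantile (R : realType) (G : R -> R) (v : R) : R :=
  inf [set y | v <= G y].

Definition quantile_of d (T : measurableType d) (R : realType)
    (P : probability T R) (Y : {RV P >-> R}) : R -> R :=
  quantile (fun y => fine (cdf Y y)).

(* [g] is a version of x |-> E[Z | X = x]. It is extended-real-valued so that a
   monotone version can be monotone on all of R even when it blows up at the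
   boundary of the support of X; by integrability it is finite almost surely. *)
Definition is_cond_exp d d' (T : measurableType d) (S : measurableType d')
    (R : realType) (P : probability T R) (X : T -> S) (Z : T -> R)
    (g : S -> \bar R) :=
  [/\ measurable_fun [set: S] g,
      P.-integrable setT (g \o X) &
      forall A : set S, measurable A ->
        (\int[P]_(w in X @^-1` A) g (X w) =
         \int[P]_(w in X @^-1` A) (Z w)%:E)%E].

(* [g] is a version of x |-> P(E | X = x). *)
Definition is_cond_prob d d' (T : measurableType d) (S : measurableType d')
    (R : realType) (P : probability T R) (X : T -> S) (E : set T)
    (g : S -> R) :=
  is_cond_exp P X (\1_E : T -> R) (EFin \o g).

(* [G] is a version of x |-> F_{Z | X = x}, every G x being a distribution
   function. *)
Definition is_cond_cdf d d' (T : measurableType d) (S : measurableType d')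
    (R : realType) (P : probability T R) (X : T -> S) (Z : T -> R)
    (G : S -> cumulativeBounded (0 : R) 1) :=
  forall y : R, is_cond_prob P X [set w | Z w <= y] (fun x => G x y).

Definition first_coords (A : Type) (p : nat) (i : 'I_p) (x : p.-tuple A) :
    i.-tuple A :=
  [tuple tnth x (widen_ord (ltnW (ltn_ord i)) j) | j < i].

(* [G i] is a version of F_{X_i | X_{<i} = x}, with coordinates numbered from 0.
   For i = 0 the conditioning vector is the empty tuple, so that G 0 [tuple] is
   the distribution function of the first coordinate. *)
Definition is_cond_cdf_family d (T : measurableType d) (R : realType)
    (P : probability T R) (p : nat) (X : T -> p.-tuple R)
    (G : forall i : nat, i.-tuple R -> cumulativeBounded (0 : R) 1) :=
  forall i : 'I_p,
    is_cond_cdf P (first_coords i \o X) (fun w => tnth (X w) i) (G i).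

(* The first n coordinates x_i = (G i (x_0, ..., x_{i-1}))^{-1}(u_i). *)
Fixpoint quantile_transform_rec (R : realType)
    (G : forall i : nat, i.-tuple R -> cumulativeBounded (0 : R) 1)
    (u : nat -> R) (n : nat) : n.-tuple R :=
  if n isn't m.+1 then [tuple]
  else let x := quantile_transform_rec G u m in
       [tuple of rcons x (quantile (G m x) (u m))].

Definition quantile_transform (R : realType)
    (G : forall i : nat, i.-tuple R -> cumulativeBounded (0 : R) 1)
    (p : nat) (u : p.-tuple R) : p.-tuple R :=
  quantile_transform_rec G (fun i => nth 0 u i) p.

(* k-dimensional Lebesgue measure, as an iterated product. *)
Fixpoint lebesgue_tuple (R : realType) (k : nat) : set (k.-tuple R) -> \bar R :=
  if k isn't m.+1 then dirac [tuple]
  else fun A => (lebesgue_measure \x @lebesgue_tuple R m)%E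
         [set z : R * m.-tuple R | A [tuple of z.1 :: z.2]].

Definition is_decreasing_rearrangement (R : realType) (k : nat)
    (h : k.-tuple R -> R) (hs : R -> R) :=
  {in `]0, 1[ &, {homo hs : s t / s <= t >-> t <= s}} /\
  forall w : R,
    lebesgue_measure [set s | 0 < s < 1 /\ w <= hs s] =
    lebesgue_tuple [set u | (forall i, 0 < tnth u i < 1) /\ w <= h u].

(* The map (u, t) |-> (F u)^{-1}(t) on (0,1) x (0,1), set to 0 outside, so that
   it can be composed with variables that are only a.s. in (0,1). *)
Definition rearranged_quantile_transform (R : realType)
    (F : R -> cumulativeBounded (0 : R) 1) (u t : R) : R :=
  if (0 < u < 1) && (0 < t < 1) then quantile (F u) t else 0.

Definition stochastically_increasing d (T : measurableType d) (R : realType)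
    (P : probability T R) (W1 W2 : {RV P >-> R}) :=
  forall f : R -> R, nondecreasing_fun f ->
    P.-integrable setT (EFin \o (f \o W1)) ->
    exists2 g : R -> \bar R,
      nondecreasing_fun g & is_cond_exp P W2 (f \o W1) g.

(* Convex order, for a.s. bounded S and S'. *)
Definition cx_le d d' (T : measurableType d) (T' : measurableType d')
    (R : realType) (P : probability T R) (S : T -> R)
    (P' : probability T' R) (S' : T' -> R) :=
  forall phi : R -> R, convex_function [set: R^o] phi ->
    ('E_P[phi \o S] <= 'E_P'[phi \o S'])%E.

(* Versions of a conditional probability exist and are a.s. equal, so
   quantifying over all of them is harmless. *)
Definition ccx_le d d' d1 d2 (T : measurableType d) (T' : measurableType d')
    (S : measurableType d1) (S' : measurableType d2) (R : realType)
    (P : probability T R) (Y : {RV P >-> R}) (X : {RV P >-> S})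
    (P' : probability T' R) (Y' : {RV P' >-> R}) (X' : {RV P' >-> S'}) :=
  forall (v : R), 0 < v < 1 -> forall (g : S -> R) (g' : S' -> R),
    is_cond_prob P X [set w | quantile_of Y v <= Y w] g ->
    is_cond_prob P' X' [set w | quantile_of Y' v <= Y' w] g' ->
    cx_le P (g \o X) P' (g' \o X').

Definition ccx_eq d d' d1 d2 (T : measurableType d) (T' : measurableType d')
    (S : measurableType d1) (S' : measurableType d2) (R : realType)
    (P : probability T R) (Y : {RV P >-> R}) (X : {RV P >-> S})
    (P' : probability T' R) (Y' : {RV P' >-> R}) (X' : {RV P' >-> S'}) :=
  ccx_le Y X Y' X' /\ ccx_le Y' X' Y X.

(* Main.v *)
(* The quantile transform of X maps the Lebesgue measure of (0,1)^p to the law of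
   X, so the rearrangement hypothesis says that, for every y, the variables F_U(y)
   and P(Y <= y | X) have the same law. With W = F_U^{-1}(V), independence makes
   F_U(y) a version of P(W <= y | U); hence W and Y have the same distribution
   function, which is (i). As y increases to c, P(Y > y) tends to P(Y >= c), so that
   P(Y > y | X) tends to P(Y >= c | X) in probability, and likewise for W and U:
   therefore P(W >= c | U) and P(Y >= c | X) have the same law, which is (iii).
   For (ii), E[f(W) | U = u] is the integral of f(F_u^{-1}(t)) over t in (0,1),
   where F_u^{-1}(t) increases with u; monotonicity turns the almost sure
   finiteness of the integrals of the positive and negative parts into finiteness
   at every u in (0,1). *)
Require Import Defs.
From HB Require Import structures.
From mathcomp Require Import all_boot all_order all_algebra.
From mathcomp Require Import all_classical all_reals all_analysis.
From mathcomp Require Import measurable_realfun.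
From mathcomp Require Import ring.

Set Implicit Arguments.
Unset Strict Implicit.
Unset Printing Implicit Defensive.
Import Order.TTheory GRing.Theory Num.Theory.
Import numFieldNormedType.Exports.
Local Open Scope classical_set_scope.
Local Open Scope ring_scope.

(** * Quantile functions and the uniform law *)

(** The limits of [G] at both ends make the set of [z] with [v <= G z] nonempty and bounded below;
    right-continuity puts its infimum in the set. *)
Lemma quantile_le (R : realType) (G : cumulativeBounded (0 : R) 1) (v y : R) :
  0 < v < 1 -> (quantile G v <= y) = (v <= G y).
Proof.
case/andP=> v0 v1; set A := [set z | v <= G z].
have Gnd : {homo G : a b / a <= b}.
  by move=> a b ab; exact: cumulative_is_nondecreasing.
have A0 : A !=set0.
  have /cvgr_ge /(_ v v1) [N [_ NH]] := cumulativey G.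
  by exists (N + 1); apply: NH; rewrite ltrDl.
have lA : has_lbound A.
  have /cvgr_lt /(_ v v0) [N [_ NH]] := cumulativeNy G.
  exists (N - 1) => z Az; rewrite leNgt; apply/negP => zN.
  have /NH : N - 1 < N by rewrite ltrBlDr ltrDl.
  by apply/negP; rewrite -leNgt (le_trans Az)// Gnd// ltW.
have hA : has_inf A by [].
apply/idP/idP => [|vG]; last exact: ge_inf.
move=> qy; suff vq : v <= G (quantile G v) by rewrite (le_trans vq)// Gnd.
rewrite leNgt; apply/negP => qv.
(* If [G] were below [v] at the infimum, it would stay below [v] just to the right of it, where the
   set has points. A right neighbourhood omits its base point, hence the separate case where [z] is
   the infimum itself. *)
have /cvgr_lt /(_ v qv) := @cumulative_is_right_continuous _ _ _ G (quantile G v).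
rewrite !near_withinE => -[e /= e0 He].
have [z Az zq] := inf_adherent e0 hA.
have := ge_inf lA Az; rewrite le_eqVlt => /predU1P[qz|qz].
  by move: Az; rewrite /A/= -qz leNgt qv.
move: Az; apply/negP; rewrite -ltNge; apply: He => //=.
by rewrite ltr0_norm ?subr_lt0// opprB ltrBlDl.
Qed.

Lemma measurable_le_set d (T : measurableType d) (R : realType) (f g : T -> R) :
  measurable_fun setT f -> measurable_fun setT g ->
  measurable [set x | f x <= g x].
Proof. by move=> mf mg; rewrite -[X in measurable X]setTI; exact: measurable_fun_le. Qed.

Lemma measurable_lt_set d (T : measurableType d) (R : realType) (f g : T -> R) :
  measurable_fun setT f -> measurable_fun setT g ->
  measurable [set x | f x < g x].
Proof.
move=> mf mg; rewrite (_ : mkset _ = ~` [set x | g x <= f x]).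
  exact/measurableC/measurable_le_set.
by apply/seteqP; split => x /=; rewrite ltNge => /negP.
Qed.

(* Composing with variables that are only almost surely in (0,1) requires a
   total function: the value 0 outside (0,1) is arbitrary. *)
Definition quantile01 (R : realType) (G : R -> R) (t : R) : R :=
  if 0 < t < 1 then quantile G t else 0.

(** By [quantile_le], where [0 < z.2 < 1] the preimage of a ray []y, +oo[] is the set on which
    [K z.1 y < z.2]. Measurability of [K] in its first argument thus gives joint measurability. *)
Lemma measurable_quantile01 d (S : measurableType d) (R : realType)
    (K : S -> cumulativeBounded (0 : R) 1) :
  (forall y, measurable_fun [set: S] (fun s => K s y)) ->
  measurable_fun [set: S * R] (fun z => quantile01 (K z.1) z.2).
Proof.
move=> mK; apply: (measurability (@RGenOInfty.G R)) => [|/= _ [_] [y] -> <-].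
  exact: RGenOInfty.measurableE.
rewrite setTI.
have m01 : measurable [set z : S * R | 0 < z.2 < 1].
  rewrite (_ : mkset _ = [set z | 0 < z.2] `&` [set z | z.2 < 1]); last first.
    by apply/seteqP; split=> z /= => [/andP[]//|[-> ->]].
  by by apply: measurableI; apply: measurable_lt_set.
rewrite (_ : _ @^-1` _ = ([set z | 0 < z.2 < 1] `&` [set z | K z.1 y < z.2]) `|`
    (~` [set z | 0 < z.2 < 1] `&` [set z | y < 0])).
  apply: measurableU; apply: measurableI => //.
  - apply: measurable_lt_set => //; exact: (measurableT_comp (mK y)).
  - exact: measurableC.
  - exact: measurable_lt_set.
apply/seteqP; split => z /=; rewrite /quantile01 in_itv/= andbT.
  case: ifPn => z01; first by rewrite [y < quantile _ _]ltNge quantile_le// -ltNge; left.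
  by right; split=> //; exact/negP.
case=> -[z01]; last by move/negP/negbTE: z01 => ->.
by rewrite z01 [y < quantile _ _]ltNge quantile_le// -ltNge.
Qed.

Lemma ge0_integral_uniform01 (R : realType) (f : R -> \bar R) :
  measurable_fun [set: R] f -> (forall x, 0 <= f x)%E ->
  (\int[uniform_prob (@ltr01 R)]_x f x =
   \int[lebesgue_measure]_(x in `]0%R, 1%R[) f x)%E.
Proof.
move=> mf f0; rewrite integral_uniform// subr0 invr1 mul1e integral_itv_bndoo//.
exact: measurable_funTS.
Qed.

Lemma uniform01E (R : realType) (B : set R) : measurable B ->
  uniform_prob (@ltr01 R) B = lebesgue_measure (B `&` `]0, 1[).
Proof.
move=> mB.
have -> : uniform_prob (@ltr01 R) B =
   (\int[uniform_prob (@ltr01 R)]_x (\1_B x)%:E)%E by rewrite integral_indic// setIT.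
rewrite ge0_integral_uniform01 ?integral_indic//.
exact/measurable_EFinP/measurable_indic.
Qed.

(** The closed unit interval, unlike the open one, contains every interval with end points in [0,1],
    whatever the types of its ends. *)
Lemma uniform01_ccE (R : realType) (B : set R) : measurable B ->
  uniform_prob (@ltr01 R) B = lebesgue_measure (B `&` `[0, 1]).
Proof.
move=> mB.
have -> : uniform_prob (@ltr01 R) B =
   (\int[uniform_prob (@ltr01 R)]_x (\1_B x)%:E)%E by rewrite integral_indic// setIT.
rewrite integral_uniform//; last exact/measurable_EFinP/measurable_indic.
by rewrite subr0 invr1 mul1e integral_indic.
Qed.

Lemma uniform01_itv (R : realType) (l r : bool) (a b : R) :
  0 <= a -> a <= b -> b <= 1 ->
  uniform_prob (@ltr01 R) [set` Interval (BSide l a) (BSide r b)] = (b - a)%:E.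
Proof.
move=> a0 ab b1; rewrite uniform01_ccE// setIidl; last first.
  by apply: subset_itv; [case: l|case: r]; rewrite bnd_simp.
rewrite lebesgue_measure_itv/= lte_fin -EFinB.
by case: ltP => // ba; congr EFin; apply/esym/eqP; rewrite subr_eq0 eq_le ba ab.
Qed.

Lemma cumulativeBounded_ge0 (R : realType) (G : cumulativeBounded (0 : R) 1) y :
  0 <= G y.
Proof.
rewrite leNgt; apply/negP => y0.
have /cvgr_gt /(_ _ y0) [N [_ NH]] := cumulativeNy G.
have : Num.min y N - 1 < N by rewrite ltrBlDr ltr_pwDr// ge_min lexx orbT.
move/NH; apply/negP; rewrite -leNgt; apply: cumulative_is_nondecreasing.
by rewrite lerBlDr ler_wpDr// ge_min lexx.
Qed.

Lemma cumulativeBounded_le1 (R : realType) (G : cumulativeBounded (0 : R) 1) y :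
  G y <= 1.
Proof.
rewrite leNgt; apply/negP => y1.
have /cvgr_lt /(_ _ y1) [N [_ NH]] := cumulativey G.
have : N < Num.max y N + 1 by rewrite ltr_pwDr// le_max lexx orbT.
move/NH; apply/negP; rewrite -leNgt; apply: cumulative_is_nondecreasing.
by rewrite ler_wpDr// le_max lexx.
Qed.

(** Inverse transform sampling: within (0,1) the event is [t <= G y], by [quantile_le]. *)
Lemma uniform01_quantile01 (R : realType) (G : cumulativeBounded (0 : R) 1) y :
  uniform_prob (@ltr01 R) [set t | quantile01 G t <= y] = (G y)%:E.
Proof.
have mq : measurable_fun setT (quantile01 G).
  (* A one-point parameter space reduces the joint statement to measurability in [t] alone. *)
  have /= := @measurable_quantile01 _ unit R (fun=> G) (fun=> @measurable_cst _ _ _ _ _ _).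
  by move=> /measurableT_comp /(_ (pair1_measurable tt)).
have mS : measurable [set t | quantile01 G t <= y].
  exact: measurable_le_set.
rewrite uniform01E//.
have -> : [set t | quantile01 G t <= y] `&` `]0, 1[ = `]0, G y] `&` `]0, 1[.
  apply/seteqP; split => t /=; rewrite /quantile01 !in_itv/=.
    by move=> [+ t01]; rewrite t01 quantile_le//; case/andP: t01 => -> _ ->.
  by move=> [/andP[_ tG] t01]; rewrite t01 quantile_le.
rewrite -uniform01E// uniform01_itv ?subr0//.
- exact: cumulativeBounded_ge0.
- exact: cumulativeBounded_le1.
Qed.

(** * Laws determined by rays *)

Lemma bigcup_itv_opp_nat (R : realType) (b : bool) :
  \bigcup_n [set` Interval (BSide b (- n%:R)) +oo%O] = [set: R].
Proof.
rewrite -subTset => x _; exists (Num.bound `|x|) => //=.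
have xn : - (Num.bound `|x|)%:R < x.
  by rewrite ltrNl (le_lt_trans (ler_norm _))// normrN archi_boundP.
by rewrite /= in_itv/= andbT; case: b; rewrite /= ?ltW.
Qed.

(** The products of a measurable set with an open upper ray form a pi-system generating the product
    sigma-algebra. Lower rays appear in the hypothesis because conditional distribution functions
    give exactly those masses. *)
Lemma prod_measure_eq_rays d (S : measurableType d) (R : realType)
    (Q1 Q2 : probability (S * R)%type R) :
  (forall A, measurable A -> Q1 (A `*` setT) = Q2 (A `*` setT)) ->
  (forall A y, measurable A -> Q1 (A `*` `]-oo, y]) = Q2 (A `*` `]-oo, y])) ->
  forall X, measurable X -> Q1 X = Q2 X.
Proof.
move=> Q12T Q12 X mX.
pose C : set (set (S * R)) :=
  [set E | exists2 A, measurable A & exists y : R, E = A `*` `]y, +oo[].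
have mC : measurable = <<s C >>.
  rewrite measurable_prod_measurableType; apply/seteqP; split.
    apply: smallest_sub; first exact: smallest_sigma_algebra.
    move=> _ [A mA [B mB <-]].
    (* A rectangle is the strip over [A] cut by a condition on the second coordinate; the strip is a
       countable union of generators. *)
    have -> : A `*` B = (A `*` setT) `&` (snd @^-1` B).
      by apply/seteqP; split => -[a b] /= => [[]|[[]]].
    apply: (@measurableI _ (g_sigma_algebraType C)).
      have -> : A `*` [set: R] = \bigcup_n (A `*` `](- n%:R), +oo[).
        by rewrite -setX_bigcupr bigcup_itv_opp_nat.
      apply: bigcupT_measurable => n; apply: sub_sigma_algebra.
      by exists A => //; exists (- n%:R).
    have msnd : @measurable_fun _ _ (g_sigma_algebraType C) R setT snd.
      apply: (measurability (@RGenOInfty.G R)) => [|/= _ [_ [y ->] <-]].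
        exact: RGenOInfty.measurableE.
      apply: sub_sigma_algebra; exists setT => //; exists y.
      by apply/seteqP; split => -[a b] /=; rewrite in_itv => -[].
    by rewrite -[X in measurable X]setTI; exact: msnd.
  apply: smallest_sub; first exact: smallest_sigma_algebra.
  move=> _ [A mA [y ->]]; apply: sub_sigma_algebra.
  by exists A => //; exists `]y, +oo[%classic.
apply: (measure_unique C (fun n => setT `*` `](- n%:R), +oo[) mC) => //.
- move=> _ _ [A mA [y ->]] [B mB [z ->]].
  exists (A `&` B); first exact: measurableI.
  exists (Num.max y z); rewrite -setXI; congr (_ `*` _).
  by apply/seteqP; split => t /=; rewrite !in_itv/= !andbT gt_max => /andP.
- by move=> n; exists setT => //; exists (- n%:R).
- by rewrite -setX_bigcupr bigcup_itv_opp_nat setXTT.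
- move=> _ [A mA [y ->]].
  (* A generator is a strip minus its lower part, and both of these have the same finite mass under
     [Q1] and [Q2]. *)
  have -> : A `*` `]y, +oo[%classic = A `*` setT `\` A `*` `]-oo, y].
    apply/seteqP; split => -[a b] /=; rewrite !in_itv/= andbT ltNge.
      by move=> [Aa /negP yb]; split=> // -[].
    by move=> [[Aa _] /not_andP[//|/negP]].
  have fin (Q : probability (S * R)%type R) E : measurable E -> (Q E < +oo)%E.
    by move=> mE; rewrite (le_lt_trans (probability_le1 _ _))// ltry.
  rewrite !measureD ?fin//; try exact: measurableX.
  rewrite !setIidr; last by move=> -[a b] [].
  by congr (_ - _)%E; [exact: Q12T|exact: Q12].
- move=> k; rewrite (le_lt_trans (probability_le1 _ _)) ?ltry//.
  exact: measurableX.
Qed.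

Lemma measure_eq_rays (R : realType) (Q1 Q2 : probability R R) :
  (forall y, Q1 `[y, +oo[%classic = Q2 `[y, +oo[%classic) ->
  forall X, measurable X -> Q1 X = Q2 X.
Proof.
move=> Q12.
apply: (measure_unique (@RGenCInfty.G R) (fun n => `[(- n%:R), +oo[%classic)) => //.
- exact: RGenCInfty.measurableE.
- move=> _ _ [y ->] [z ->]; exists (Num.max y z).
  by apply/seteqP; split => t /=; rewrite !in_itv/= !andbT ge_max => /andP.
- by move=> n; exists (- n%:R).
- exact: bigcup_itv_opp_nat.
- by move=> A; rewrite /RGenCInfty.G/= => -[y ->].
- by move=> k; rewrite (le_lt_trans (probability_le1 _ _))// ltry.
Qed.

(** Closed upper rays form a pi-system generating the Borel sets. The hypothesis has the shape of
    the equation defining a decreasing rearrangement. *)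
Lemma eq_rays_law d d' (T : measurableType d) (T' : measurableType d')
    (R : realType) (P : probability T R) (P' : probability T' R)
    (S : T -> R) (S' : T' -> R) :
  measurable_fun [set: T] S -> measurable_fun [set: T'] S' ->
  (forall w, P [set t | w <= S t] = P' [set t | w <= S' t]) ->
  forall B, measurable B -> P (S @^-1` B) = P' (S' @^-1` B).
Proof.
move=> mS mS' SS'.
pose s : {mfun T >-> R} := HB.pack S (isMeasurableFun.Build _ _ _ _ _ mS).
pose s' : {mfun T' >-> R} := HB.pack S' (isMeasurableFun.Build _ _ _ _ _ mS').
apply: (@measure_eq_rays _ (distribution P s) (distribution P' s')) => y.
by have := SS' y; rewrite /distribution /pushforward !set_itvE.
Qed.

(** The integrals of the positive and of the negative part of [phi] depend on the law only; treating
    them separately covers expectations that are infinite. *)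
Lemma eq_law_expectation d d' (T : measurableType d) (T' : measurableType d')
    (R : realType) (P : probability T R) (P' : probability T' R)
    (S : T -> R) (S' : T' -> R) (phi : R -> R) :
  measurable_fun [set: T] S -> measurable_fun [set: T'] S' ->
  (forall B, measurable B -> P (S @^-1` B) = P' (S' @^-1` B)) ->
  measurable_fun setT phi -> ('E_P[phi \o S] = 'E_P'[phi \o S'])%E.
Proof.
move=> mS mS' SS' mphi.
pose s : {mfun T >-> R} := HB.pack S (isMeasurableFun.Build _ _ _ _ _ mS).
pose s' : {mfun T' >-> R} := HB.pack S' (isMeasurableFun.Build _ _ _ _ _ mS').
have mf : measurable_fun setT (EFin \o phi) by exact/measurable_EFinP.
have I (f : R -> \bar R) : measurable_fun setT f -> (forall x, 0 <= f x)%E ->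
    (\int[P]_w (f \o S) w = \int[P']_w (f \o S') w)%E.
  move=> mf' f0; transitivity (\int[distribution P s]_x f x)%E.
    by rewrite ge0_integral_distribution.
  rewrite (eq_measure_integral (distribution P' s')) ?ge0_integral_distribution//.
  by move=> A mA _; exact: SS'.
rewrite unlock; rewrite (integralE P) (integralE P').
congr (_ - _)%E.
- rewrite (funepos_comp (EFin \o phi) S) (funepos_comp (EFin \o phi) S').
  exact: I (measurable_funepos mf) (funepos_ge0 _).
- rewrite (funeneg_comp (EFin \o phi) S) (funeneg_comp (EFin \o phi) S').
  exact: I (measurable_funeneg mf) (funeneg_ge0 _).
Qed.

(** * Conditional distribution functions *)

Lemma is_cond_cdf_measurable d d' (T : measurableType d) (S : measurableType d')
    (R : realType) (P : probability T R) (Z : T -> S) (Y : T -> R)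
    (G : S -> cumulativeBounded (0 : R) 1) :
  is_cond_cdf P Z Y G -> forall y, measurable_fun [set: S] (fun s => G s y).
Proof. by move=> hG y; have [/measurable_EFinP] := hG y. Qed.

(* Given Z, the variable Y is distributed as the quantile function of its
   conditional distribution evaluated at an independent uniform variable. *)
Lemma ge0_integral_cond_cdf d d' (T : measurableType d) (S : measurableType d')
    (R : realType) (P : probability T R) (Z : T -> S) (Y : T -> R)
    (G : S -> cumulativeBounded (0 : R) 1) (f : S * R -> \bar R) :
  measurable_fun [set: T] Z -> measurable_fun [set: T] Y ->
  is_cond_cdf P Z Y G ->
  measurable_fun [set: S * R] f -> (forall z, 0 <= f z)%E ->
  (\int[P]_w f (Z w, Y w) =
   \int[P]_w \int[uniform_prob (@ltr01 R)]_u f (Z w, quantile01 (G (Z w)) u))%E.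
Proof.
move=> mZ mY hG mf f0.
have mG := is_cond_cdf_measurable hG.
pose mu := uniform_prob (@ltr01 R).
pose psi := fun z : T * measurableTypeR R => (Z z.1, quantile01 (G (Z z.1)) z.2).
have mpsi : measurable_fun setT psi.
  apply/measurable_fun_pairP; split => /=.
    exact: (measurableT_comp mZ).
  have := @measurable_quantile01 _ _ _ (G \o Z) _; apply => y.
  exact: (measurableT_comp (mG y)).
have mZY : measurable_fun setT (fun w => (Z w, Y w)) by exact/measurable_fun_pairP.
pose ZY : {mfun T >-> (S * R)%type} :=
  HB.pack (fun w => (Z w, Y w)) (isMeasurableFun.Build _ _ _ _ _ mZY).
pose Psi : {mfun (T * measurableTypeR R)%type >-> (S * R)%type} :=
  HB.pack psi (isMeasurableFun.Build _ _ _ _ _ mpsi).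
have mZA A : measurable A -> measurable (Z @^-1` A).
  by move=> mA; rewrite -[X in measurable X]setTI; exact: mZ.
(* The law of (Z, Y) is the law of [psi] under the product of [P] and the uniform law. On a strip
   only [Z] matters; on a strip cut by a lower ray, the section over [w] has mass [G (Z w) y], whose
   integral is given by [hG]. *)
have E X : measurable X -> distribution P ZY X = distribution (P \x mu)%E Psi X.
  apply: prod_measure_eq_rays => [A mA|A y mA].
    change (P (ZY @^-1` (A `*` setT)) = (P \x mu)%E (psi @^-1` (A `*` setT))).
    rewrite (_ : _ @^-1` _ = Z @^-1` A); last by apply/seteqP; split=> w // -[].
    rewrite (_ : psi @^-1` _ = (Z @^-1` A) `*` setT); last first.
      by apply/seteqP; split=> w // -[].
    rewrite product_measure1E// ?mule1 ?[X in (_ * X)%E]probability_setT ?mule1//.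
    exact: mZA.
  change (P (ZY @^-1` (A `*` `]-oo, y])) = (P \x mu)%E (psi @^-1` (A `*` `]-oo, y]))).
  rewrite (_ : _ @^-1` _ = (Z @^-1` A) `&` [set w | Y w <= y]); last first.
    by apply/seteqP; split=> w //.
  rewrite /product_measure1.
  rewrite (eq_integral ((fun w => (G (Z w) y)%:E) \_ (Z @^-1` A))); last first.
    move=> w _; rewrite patchE; case: ifPn => [|/negP] wA /=; last first.
      rewrite (_ : xsection _ _ = set0); first exact: measure0.
      apply/seteqP; split => // t.
      by rewrite /xsection/= inE/= => -[/= wA' _]; apply: wA; rewrite inE.
    rewrite (_ : xsection _ _ = [set t | quantile01 (G (Z w)) t <= y]).
      exact: uniform01_quantile01.
    rewrite inE/= in wA.
    by apply/seteqP; split => t; rewrite /xsection/= inE/= in_itv/=; [case|].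
  rewrite -integral_mkcond; have [_ _ h] := hG y; rewrite (h A mA) integral_indic.
  - by rewrite setIC.
  - exact: mZA.
  - exact: measurable_le_set.
transitivity (\int[distribution P ZY]_z f z)%E.
  by rewrite ge0_integral_distribution.
rewrite (eq_measure_integral (distribution (P \x mu)%E Psi)); last first.
  by move=> A mA _; exact: E.
rewrite (ge0_integral_distribution Psi mf f0).
rewrite (@fubini_tonelli1 _ _ _ _ _ P mu).
- by [].
- exact: measurableT_comp.
- by move=> z; exact: f0.
Qed.

(** * The law of the quantile transform *)

Lemma measurable_rcons (R : realType) m :
  measurable_fun [set: m.-tuple R * R] (fun z => [tuple of rcons z.1 z.2]).
Proof.
apply/measurable_fun_tnthP => i.
have [im|mi] := ltnP i m.
  rewrite (_ : _ \o _ = fun z => tnth z.1 (Ordinal im)).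
    exact: (measurableT_comp (measurable_tnth (Ordinal im))).
  by apply/funext => z /=; rewrite !(tnth_nth 0)/= nth_rcons size_tuple im.
rewrite (_ : _ \o _ = snd)//; apply/funext => z /=.
by rewrite (tnth_nth 0)/= nth_rcons size_tuple ltnNge mi/= eqn_leq mi -ltnS ltn_ord.
Qed.

(* A continuation of quantile_transform_rec from an arbitrary prefix x, so that
   the coordinates of u can be integrated out from the first one, as in
   lebesgue_tuple. It is list-valued to avoid casts between lengths. *)
Fixpoint quantile_extend (R : realType)
    (G : forall i : nat, i.-tuple R -> cumulativeBounded (0 : R) 1)
    (u : seq R) (m : nat) (x : m.-tuple R) : seq R :=
  if u isn't a :: u' then x
  else quantile_extend G u' [tuple of rcons x (quantile (G m x) a)].

(** Computing [m + k] coordinates at once amounts to computing [m] of them and extending by [k]; the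
    induction on [k] needs every starting index [m]. *)
Lemma quantile_transformE (R : realType)
    (G : forall i : nat, i.-tuple R -> cumulativeBounded (0 : R) 1)
    (p : nat) (u : p.-tuple R) :
  quantile_transform G u = quantile_extend G u [tuple] :> seq R.
Proof.
have E (f : nat -> R) k m :
    quantile_transform_rec G f (m + k) =
    quantile_extend G [seq f i | i <- iota m k] (quantile_transform_rec G f m) :> seq R.
  elim: k m => [|k IHk] m; first by rewrite addn0.
  by rewrite -addSnnS IHk.
rewrite /quantile_transform (E _ p 0).
have -> // : [seq nth 0 u i | i <- iota 0 p] = u.
by rewrite -[RHS](@mkseq_nth _ 0) size_tuple.
Qed.

(** Coordinates are read from a list with default 0, so that [m] need not be tied by a proof to the
    length of [s], in contrast with [first_coords]. *)
Definition tuple_prefix (R : realType) m (s : seq R) : m.-tuple R :=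
  [tuple nth 0 s j | j < m].

Lemma rcons_tuple_prefix (R : realType) m (s : seq R) :
  [tuple of rcons (tuple_prefix m s) (nth 0 s m)] = tuple_prefix m.+1 s.
Proof.
apply: eq_from_tnth => i.
rewrite tnth_mktuple (tnth_nth 0)/= nth_rcons size_map size_enum_ord.
have [im|mi] := ltnP i m.
  by have := tnth_mktuple (fun j : 'I_m => nth 0 s j) (Ordinal im); rewrite (tnth_nth 0).
have im : nat_of_ord i = m by apply/eqP; rewrite eqn_leq mi -ltnS ltn_ord.
by rewrite im eqxx.
Qed.

Lemma tuple_prefix_id (R : realType) p (s : p.-tuple R) : tuple_prefix p s = s.
Proof. by apply: eq_from_tnth => i; rewrite tnth_mktuple (tnth_nth 0). Qed.

Lemma first_coordsE (R : realType) p (i : 'I_p) (s : p.-tuple R) :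
  first_coords i s = tuple_prefix i s.
Proof. by apply: eq_from_tnth => j; rewrite !tnth_mktuple (tnth_nth 0). Qed.

Lemma measurable_tuple_prefix (R : realType) p m : (m <= p)%N ->
  measurable_fun [set: p.-tuple R] (fun s => tuple_prefix m s).
Proof.
move=> mp; apply/measurable_fun_tnthP => i.
rewrite (_ : _ \o _ = fun z => tnth z (widen_ord mp i)); first exact: measurable_tnth.
by apply/funext => z /=; rewrite tnth_mktuple (tnth_nth 0).
Qed.

Lemma lebesgue_tupleS (R : realType) k (A : set (k.+1.-tuple R)) :
  lebesgue_tuple A =
  (\int[lebesgue_measure]_a lebesgue_tuple [set u : k.-tuple R | A [tuple of a :: u]])%E.
Proof.
rewrite /= /product_measure1; apply: eq_integral => a _ /=; congr lebesgue_tuple.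
by apply/seteqP; split => u; rewrite /xsection/= inE.
Qed.

(** [lebesgue_tuple] is a recursive set function rather than a bundled measure, so its basic
    properties go by induction on the dimension. *)
Lemma lebesgue_tuple0 (R : realType) k : @lebesgue_tuple R k set0 = 0%E.
Proof.
elim: k => [|k IHk]; first exact: measure0.
by rewrite lebesgue_tupleS integral0_eq.
Qed.

(** For [m + k = p] this is a candidate for the conditional probability that the whole vector lies
    in [B], given that its first [m] coordinates are [x]. Taking [B] among sets of lists lets the
    same [B] serve every [m] and [k]. *)
Definition extend_measure (R : realType)
    (G : forall i : nat, i.-tuple R -> cumulativeBounded (0 : R) 1)
    (B : set (seq R)) k m (x : m.-tuple R) : \bar R :=
  lebesgue_tuple
    [set u : k.-tuple R | (forall i, 0 < tnth u i < 1) /\ B (quantile_extend G u x)].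

Lemma extend_measure_ge0 (R : realType)
    (G : forall i : nat, i.-tuple R -> cumulativeBounded (0 : R) 1)
    (B : set (seq R)) k m (x : m.-tuple R) : (0 <= extend_measure G B k x)%E.
Proof.
rewrite /extend_measure; move: (X in lebesgue_tuple X) => A {x}.
elim: k A => [|k IHk] A; first exact: measure_ge0.
by rewrite lebesgue_tupleS integral_ge0.
Qed.

Lemma extend_measure0 (R : realType)
    (G : forall i : nat, i.-tuple R -> cumulativeBounded (0 : R) 1)
    (B : set (seq R)) m (x : m.-tuple R) :
  extend_measure G B 0 x = (\1_(fun x : m.-tuple R => B x) x)%:E.
Proof.
rewrite /extend_measure /= diracE indicE; congr (_%:R%:E); congr nat_of_bool.
by apply/idP/idP; rewrite !inE/=; [case|move=> Bx; split=> // -[]].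
Qed.

(** The first remaining coordinate [a] is integrated out. For [a] outside (0,1) the section is
    empty; inside, [quantile01] is [quantile]. *)
Lemma extend_measureS (R : realType)
    (G : forall i : nat, i.-tuple R -> cumulativeBounded (0 : R) 1)
    (B : set (seq R)) k m (x : m.-tuple R) :
  (forall y, measurable_fun [set: m.-tuple R] (fun x => G m x y)) ->
  measurable_fun [set: m.+1.-tuple R] (@extend_measure R G B k m.+1) ->
  (extend_measure G B k.+1 x = \int[uniform_prob (@ltr01 R)]_a
     extend_measure G B k [tuple of rcons x (quantile01 (G m x) a)])%E.
Proof.
move=> mG mE; rewrite ge0_integral_uniform01; last 2 first.
- apply: (measurableT_comp mE).
  have mh : measurable_fun [set: R] (fun a : R => (x, quantile01 (G m x) a)).
    apply/measurable_fun_pairP; split; first exact: measurable_cst.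
    exact: (measurableT_comp (measurable_quantile01 mG) (pair1_measurable x)).
  exact: (measurableT_comp (@measurable_rcons R m) mh).
- by move=> a; exact: extend_measure_ge0.
rewrite /extend_measure lebesgue_tupleS [RHS]integral_mkcond.
apply: eq_integral => a _; rewrite patchE; case: ifPn => [|/negP] a01.
  rewrite inE/= in_itv/= in a01.
  congr lebesgue_tuple; apply/seteqP; split => u /=; rewrite /quantile01 a01.
    by move=> [u01 Bu]; split=> // i; have := u01 (lift ord0 i); rewrite tnthS.
  move=> [u01 Bu]; split=> // i; have [j ->|->] := unliftP ord0 i.
    by rewrite tnthS.
  by rewrite tnth0.
rewrite -[RHS](@lebesgue_tuple0 R k).
congr lebesgue_tuple; apply/seteqP; split => u //= -[u01 _].
by case: a01; rewrite inE/= in_itv/=; have := u01 ord0; rewrite tnth0.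
Qed.

(** Each step of the recursion is a partial integral of a nonnegative jointly measurable function,
    so Tonelli's theorem propagates measurability. *)
Lemma measurable_extend_measure (R : realType)
    (G : forall i : nat, i.-tuple R -> cumulativeBounded (0 : R) 1)
    (B : set (seq R)) n :
  measurable [set x : n.-tuple R | B x] ->
  (forall m y, (m < n)%N -> measurable_fun [set: m.-tuple R] (fun x => G m x y)) ->
  forall k m, (m + k)%N = n ->
  measurable_fun [set: m.-tuple R] (@extend_measure R G B k m).
Proof.
move=> mB mG; elim => [|k IHk] m mkn.
  rewrite addn0 in mkn; subst m.
  rewrite (_ : @extend_measure _ _ _ _ _ = fun x => (\1_(fun x : n.-tuple R => B x) x)%:E).
    exact/measurable_EFinP/measurable_indic.
  by apply/funext => x; exact: extend_measure0.
have mn : (m < n)%N by rewrite -mkn addnS ltnS leq_addr.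
have mE : measurable_fun [set: m.+1.-tuple R] (@extend_measure R G B k m.+1).
  by apply: IHk; rewrite addSnnS.
rewrite (_ : @extend_measure _ _ _ _ _ = fun x => (\int[uniform_prob (@ltr01 R)]_a
     extend_measure G B k [tuple of rcons x (quantile01 (G m x) a)])%E); last first.
  by apply/funext => x; apply: extend_measureS => // y; exact: mG.
pose f (z : m.-tuple R * measurableTypeR R) :=
  extend_measure G B k [tuple of rcons z.1 (quantile01 (G m z.1) z.2)].
have mf : measurable_fun setT f.
  apply: (measurableT_comp mE).
  have mh : measurable_fun setT
      (fun z : m.-tuple R * measurableTypeR R => (z.1, quantile01 (G m z.1) z.2)).
    apply/measurable_fun_pairP; split; first exact: measurable_fst.
    by apply: measurable_quantile01 => y; exact: mG.
  exact: (measurableT_comp (@measurable_rcons R m) mh).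
have f0 z : (0 <= f z)%E by exact: extend_measure_ge0.
exact: (@measurable_fun_fubini_tonelli_F _ _ _ _ R (uniform_prob (@ltr01 R)) f mf f0).
Qed.

(** A tower property: the expectation does not depend on the length [m] of the prefix. For the full
    prefix, [extend_measure] is the indicator of [B]; the induction on [k] then shortens the prefix
    one coordinate at a time. *)
Lemma extend_measure_prefix d (T : measurableType d) (R : realType)
    (P : probability T R) (p : nat) (X : {RV P >-> p.-tuple R})
    (G : forall i : nat, i.-tuple R -> cumulativeBounded (0 : R) 1)
    (B : set (seq R)) :
  is_cond_cdf_family P X G ->
  measurable [set x : p.-tuple R | B x] ->
  forall k m, (m + k)%N = p ->
  (\int[P]_w extend_measure G B k (tuple_prefix m (X w)) =
   P [set w | B (X w)])%E.
Proof.
move=> hG mB.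
have cG m (mp : (m < p)%N) :
    is_cond_cdf P (fun w => tuple_prefix m (X w)) (fun w => (X w)`_m) (G m).
  have := hG (Ordinal mp).
  rewrite (_ : _ \o _ = fun w => tuple_prefix m (X w)); last first.
    by apply/funext => w /=; rewrite first_coordsE.
  rewrite (_ : (fun w => tnth _ _) = fun w => (X w)`_m)//.
  by apply/funext => w; rewrite (tnth_nth 0).
have mX m : (m <= p)%N -> measurable_fun [set: T] (fun w => tuple_prefix m (X w)).
  move=> mp; exact: (measurableT_comp (measurable_tuple_prefix mp)).
have mXm m : (m < p)%N -> measurable_fun [set: T] (fun w => (X w)`_m).
  move=> mp; rewrite (_ : (fun w => _) = (fun x => tnth x (Ordinal mp)) \o X).
    exact: (measurableT_comp (measurable_tnth (Ordinal mp))).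
  by apply/funext => w; rewrite /= (tnth_nth 0).
have mG m y : (m < p)%N -> measurable_fun [set: m.-tuple R] (fun x => G m x y).
  by move=> mp; exact: (is_cond_cdf_measurable (cG m mp)).
elim => [|k IHk] m mkp.
  rewrite addn0 in mkp; subst m.
  under eq_integral do rewrite extend_measure0 tuple_prefix_id.
  rewrite -[LHS]/(\int[P]_w (\1_(X @^-1` [set x : p.-tuple R | B x]) w)%:E)%E.
  rewrite integral_indic ?setIT//.
  exact: measurable_funPTI.
have mp : (m < p)%N by rewrite -mkp addnS ltnS leq_addr.
have mE : measurable_fun [set: m.+1.-tuple R] (@extend_measure R G B k m.+1).
  by apply: (measurable_extend_measure mB) => //; rewrite addSnnS.
rewrite -(IHk m.+1) ?addSnnS//.
pose f (z : m.-tuple R * R) := extend_measure G B k [tuple of rcons z.1 z.2].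
have mf : measurable_fun setT f by exact: (measurableT_comp mE (@measurable_rcons R m)).
have f0 z : (0 <= f z)%E by exact: extend_measure_ge0.
(* Given the first [m] coordinates, the next one is replaced by its conditional quantile function at
   a uniform variable, and [extend_measureS] recognizes the inner integral. *)
have := ge0_integral_cond_cdf (mX m (ltnW mp)) (mXm m mp) (cG m mp) mf f0.
rewrite (eq_integral (fun w => extend_measure G B k (tuple_prefix m.+1 (X w)))); last first.
  by move=> w _; rewrite /f/= rcons_tuple_prefix.
move=> ->; apply: eq_integral => w _.
by apply: extend_measureS => // y; exact: mG.
Qed.

(** The empty prefix in [extend_measure_prefix]: the integrand is then constant, equal to the
    Lebesgue measure on the left. *)
Lemma quantile_transform_law d (T : measurableType d) (R : realType)
    (P : probability T R) (p : nat) (X : {RV P >-> p.-tuple R})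
    (G : forall i : nat, i.-tuple R -> cumulativeBounded (0 : R) 1)
    (B : set (p.-tuple R)) :
  is_cond_cdf_family P X G -> measurable B ->
  (lebesgue_tuple
    [set u : p.-tuple R | (forall i, 0 < tnth u i < 1)%R /\ B (quantile_transform G u)] =
   P (X @^-1` B))%E.
Proof.
move=> hG mB; pose B' : set (seq R) := [set s | B (tuple_prefix p s)].
have B'E (x : p.-tuple R) : B' x = B x by rewrite /B'/= tuple_prefix_id.
have mB' : measurable [set x : p.-tuple R | B' x].
  by rewrite (_ : mkset _ = B)//; apply/funext.
have := extend_measure_prefix hG mB' (add0n p).
under eq_integral do rewrite (_ : tuple_prefix 0 _ = [tuple]) ?tuple0//.
rewrite integral_cst// [X in (_ * X)%E = _](probability_setT P) mule1 => H.
rewrite (_ : X @^-1` B = [set w | B' (X w)]); last by apply/funext => w /=; rewrite B'E.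
rewrite -H /extend_measure; congr lebesgue_tuple; apply/funext => u /=.
by rewrite -quantile_transformE B'E.
Qed.

(** * Laws of conditional probabilities *)

Lemma measurable_preimage d d' (T : measurableType d) (S : measurableType d')
    (f : T -> S) (B : set S) :
  measurable_fun [set: T] f -> measurable B -> measurable (f @^-1` B).
Proof. by move=> mf mB; rewrite -[X in measurable X]setTI; exact: mf. Qed.

Section conditional_probability.
Context d d' (T : measurableType d) (S : measurableType d') (R : realType).
Variables (P : probability T R) (X : T -> S).
Hypothesis mX : measurable_fun [set: T] X.
Implicit Types (E : set T) (h g : S -> R).

Lemma is_cond_probE E h : measurable E -> is_cond_prob P X E h ->
  forall A, measurable A ->
  (\int[P]_(w in X @^-1` A) (h (X w))%:E = P (E `&` X @^-1` A))%E.
Proof.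
move=> mE [_ _ hE] A mA; rewrite (hE A mA) integral_indic//.
exact: measurable_preimage.
Qed.

Lemma is_cond_prob_measurable E h : is_cond_prob P X E h ->
  measurable_fun [set: S] h.
Proof. by case=> /measurable_EFinP. Qed.

Lemma is_cond_probC E h : measurable E -> is_cond_prob P X E h ->
  is_cond_prob P X (~` E) (fun s => 1 - h s).
Proof.
move=> mE hE; have mh := is_cond_prob_measurable hE.
have [_ ih _] := hE; have h1 := is_cond_probE mE hE.
have i1 : P.-integrable setT (cst 1%:E : T -> \bar R).
  exact: finite_measure_integrable_cst.
split.
- by apply/measurable_EFinP; exact: measurable_funB.
- rewrite (_ : _ \o _ = cst 1%:E \- (EFin \o h) \o X)%E; last exact/funext.
  exact: integrableB.
- move=> A mA; have mXA := measurable_preimage mX mA.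
  have -> : (\int[P]_(w in X @^-1` A) (EFin \o (fun s => 1 - h s)%R) (X w) =
      \int[P]_(w in X @^-1` A) (cst 1%:E w - (h (X w))%:E))%E by [].
  rewrite integralB//; [|exact: integrableS i1|exact: integrableS ih].
  rewrite (h1 A mA) integral_cst// mul1e integral_indic//; last exact: measurableC.
  by rewrite [in RHS]setIC -setDE measureD// ?ltey_eq ?fin_num_measure// setIC.
Qed.

(** A Markov-type bound. On the event, [h1 - h2] is at least [e], while its integral there is a
    difference of probabilities of [E1] and [E2] inside that event, hence at most [P (E1 \ E2)]. *)
Lemma is_cond_prob_separation E1 E2 h1 h2 (w e : R) :
  measurable E1 -> measurable E2 ->
  is_cond_prob P X E1 h1 -> is_cond_prob P X E2 h2 -> 0 < e ->
  (e%:E * P [set t | (w + e <= h1 (X t))%R /\ (h2 (X t) < w)%R] <= P (E1 `\` E2))%E.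
Proof.
move=> mE1 mE2 hE1 hE2 e0.
have [_ i1 _] := hE1; have [_ i2 _] := hE2.
have m1 := is_cond_prob_measurable hE1; have m2 := is_cond_prob_measurable hE2.
pose A := [set s | w + e <= h1 s] `&` [set s | h2 s < w].
have mA : measurable A.
  by apply: measurableI; [exact: measurable_le_set|exact: measurable_lt_set].
have mXA := measurable_preimage mX mA.
rewrite -[X in (_ * P X)%E]/(X @^-1` A) -integral_cst//.
apply: (@le_trans _ _ (\int[P]_(t in X @^-1` A) ((h1 (X t))%:E - (h2 (X t))%:E))%E).
  apply: ge0_le_integral => //.
  - by move=> *; rewrite lee_fin ltW.
  - by apply: measurable_funTS; apply/measurable_EFinP; apply: measurable_funB;
      exact: measurableT_comp.
  - move=> t [/= wh1 h2w]; rewrite -EFinB lee_fin.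
    by rewrite lerBrDl (le_trans _ wh1)// lerD2r ltW.
rewrite integralB//; [|exact: integrableS i1|exact: integrableS i2].
rewrite (is_cond_probE mE1 hE1 mA) (is_cond_probE mE2 hE2 mA).
rewrite leeBlDr ?fin_num_measure//; [|exact: measurableI].
apply: (@le_trans _ _ (P ((E1 `\` E2) `|` (E2 `&` X @^-1` A)))).
  apply: le_measure; rewrite ?inE; [exact: measurableI| |].
    by apply: measurableU; [exact: measurableD|exact: measurableI].
  move=> t [E1t At]; have [E2t|E2t] := pselect (E2 t); [by right|by left].
by apply: measureU2; [exact: measurableD|exact: measurableI].
Qed.

(** Where [w + e <= h1], either [w <= h2] or the separation event occurs, and the latter has
    probability at most [delta]. *)
Lemma is_cond_prob_le_rays E1 E2 h1 h2 (w e delta : R) :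
  measurable E1 -> measurable E2 ->
  is_cond_prob P X E1 h1 -> is_cond_prob P X E2 h2 -> 0 < e ->
  (P (E1 `\` E2) <= (e * delta)%:E)%E ->
  (P [set t | (w + e <= h1 (X t))%R] <= P [set t | (w <= h2 (X t))%R] + delta%:E)%E.
Proof.
move=> mE1 mE2 hE1 hE2 e0 Pd.
have m1 := measurableT_comp (is_cond_prob_measurable hE1) mX.
have m2 := measurableT_comp (is_cond_prob_measurable hE2) mX.
have mw2 : measurable [set t | w <= h2 (X t)] by exact: measurable_le_set.
have mw1 : measurable [set t | w + e <= h1 (X t)] by exact: measurable_le_set.
have mN : measurable [set t | w + e <= h1 (X t) /\ h2 (X t) < w].
  by apply: measurableI => //; exact: measurable_lt_set.
apply: (@le_trans _ _ (P ([set t | w <= h2 (X t)] `|`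
    [set t | w + e <= h1 (X t) /\ h2 (X t) < w]))).
  apply: le_measure; rewrite ?inE//; first exact: measurableU.
  by move=> t /= h1t; case: (leP w (h2 (X t))); [left|right].
apply: le_trans (measureU2 _ mw2 mN) _; rewrite leeD2l//.
have := le_trans (is_cond_prob_separation w mE1 mE2 hE1 hE2 e0) Pd.
by rewrite EFinM lee_pmul2l.
Qed.

End conditional_probability.

(** A comparison through [h] and [h'], which have the same law: [E] is almost contained in [F], and
    [F'] in [E']. Each passage lowers the threshold by [e] and adds [e] to the probability; then [e]
    tends to 0. *)
Lemma is_cond_prob_approx_le d d' d1 d2 (T : measurableType d)
    (T' : measurableType d') (S : measurableType d1) (S' : measurableType d2)
    (R : realType) (P : probability T R) (X : T -> S) (P' : probability T' R)
    (X' : T' -> S') (E : set T) (E' : set T') (g : S -> R) (g' : S' -> R) :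
  measurable_fun [set: T] X -> measurable_fun [set: T'] X' ->
  measurable E -> measurable E' ->
  is_cond_prob P X E g -> is_cond_prob P' X' E' g' ->
  (forall e : R, 0 < e -> exists F F' h h',
     [/\ measurable F, measurable F', is_cond_prob P X F h, is_cond_prob P' X' F' h' &
     [/\ forall w, P [set t | w <= h (X t)] = P' [set t | w <= h' (X' t)],
         (P (E `\` F) <= e%:E)%E & (P' (F' `\` E') <= e%:E)%E]]) ->
  forall w, (P [set t | (w <= g (X t))%R] <= P' [set t | (w <= g' (X' t))%R])%E.
Proof.
move=> mX mX' mE mE' gE gE' approx w.
pose e n : R := n.+1%:R^-1.
have e0 n : 0 < e n by rewrite invr_gt0.
have mg' := measurableT_comp (is_cond_prob_measurable gE') mX'.
pose D n := [set t | w - 2 * e n <= g' (X' t)].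
have step n : (P [set t | (w <= g (X t))%R] <= P' (D n) + (2 * e n)%:E)%E.
  (* The accuracy is the square of [e n] because [is_cond_prob_le_rays] divides the mass of the
     difference by [e n]. *)
  have [F [F' [h [h' [mF mF' hF hF' [hh' EF FE']]]]]] :=
    approx (e n * e n) (mulr_gt0 (e0 n) (e0 n)).
  have := is_cond_prob_le_rays mX (w - e n) mE mF gE hF (e0 n) EF.
  rewrite subrK => /le_trans; apply.
  rewrite hh'; have := is_cond_prob_le_rays mX' (w - 2 * e n) mF' mE' hF' gE' (e0 n) FE'.
  have -> : w - 2 * e n + e n = w - e n by rewrite mulr_natl mulr2n opprD addrA subrK.
  move=> /(leeD2r (e n)%:E) /le_trans; apply.
  rewrite -addeA -EFinD (_ : e n + e n = 2 * e n)%R; last first.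
    by rewrite mulr_natl.
  exact: lexx.
(* Continuity from above: the lowered thresholds increase to [w], so the closed conditions [D n]
   decrease to [w <= g']. *)
have cD : P' (D n) @[n --> \oo] --> P' (\bigcap_n D n).
  apply: nonincreasing_cvg_mu.
  - by rewrite -ge0_fin_numE// fin_num_measure//; exact: measurable_le_set.
  - by move=> n; exact: measurable_le_set.
  - by apply: bigcap_measurable => // n _; exact: measurable_le_set.
  - move=> n m nm; apply/subsetPset => t /=; apply: le_trans.
    by rewrite lerD2l lerN2 ler_pM2l// lef_pV2 ?posrE// ler_nat.
have ce : (2 * e n)%:E @[n --> \oo] --> 0%E.
  apply: cvg_EFin; first exact: nearW.
  rewrite -[X in _ --> X](mulr0 2); apply: cvgM; first exact: cvg_cst.
  exact: cvg_harmonic.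
have -> : [set t | w <= g' (X' t)] = \bigcap_n D n.
  apply/seteqP; split => t /= wt.
    by move=> n _; apply: le_trans wt; rewrite gerBl mulr_ge0// ltW.
  rewrite leNgt; apply/negP => gw.
  have /ltr_add_invr[n] : 0 < (w - g' (X' t)) / 2 by rewrite divr_gt0// subr_gt0.
  rewrite add0r ltr_pdivlMr// => en; have : w - 2 * e n <= g' (X' t) := wt n I.
  by rewrite leNgt ltrBrDr -ltrBrDl mulrC en.
rewrite -[leRHS]adde0.
have cDe := cvgeD (fin_num_adde_defl _ _) cD ce.
by apply: (cvge_ge _ (cDe _ _)) => //; exact: nearW.
Qed.

(** The sublevel sets of a convex function on the line are intervals. *)
Lemma convex_function_measurable (R : realType) (phi : R -> R) :
  convex_function [set: R^o] phi -> measurable_fun [set: R] phi.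
Proof.
move=> cphi; apply: (measurability (@RGenOInfty.G R)) => [|/= _ [_] [y] -> <-].
  exact: RGenOInfty.measurableE.
rewrite setTI (_ : _ @^-1` _ = ~` [set x | phi x <= y]); last first.
  by apply/seteqP; split => x /=; rewrite in_itv/= andbT ltNge => /negP.
apply: measurableC; apply: is_interval_measurable => s t /= ps pt u /andP[su ut].
have [st|ts] := ltP s t; last first.
  by rewrite (_ : u = t)//; apply/eqP; rewrite eq_le ut (le_trans ts).
have ts0 : 0 < t - s by rewrite subr_gt0.
have a0 : 0 <= (t - u) / (t - s) by rewrite divr_ge0 ?subr_ge0// ltW.
have a1 : (t - u) / (t - s) <= 1 by rewrite ler_pdivrMr// mul1r lerD2l lerN2.
(* The weight on [s] for which the convex combination of [s] and [t] is [u]. *)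
pose a := Itv01 a0 a1.
have := cphi a s t; rewrite !inE => /(_ I I).
have -> : (conv a (s : convex_lmodType R^o) t) = u.
  rewrite -[LHS]/((t - u) / (t - s) * s + (1 - (t - u) / (t - s)) * t).
  by field; rewrite gt_eqF.
move=> /le_trans; apply.
rewrite -[X in X <= _]/((t - u) / (t - s) * phi s + (1 - (t - u) / (t - s)) * phi t).
rewrite [leRHS](_ : y = (t - u) / (t - s) * y + (1 - (t - u) / (t - s)) * y); last by ring.
by apply: lerD; rewrite ler_wpM2l// subr_ge0.
Qed.

(** The events that [Y] lies strictly between [c - 1/(n+1)] and [c] decrease to the empty set. *)
Lemma probability_left_approx d (T : measurableType d) (R : realType)
    (P : probability T R) (Y : {RV P >-> R}) (c e : R) : 0 < e ->
  exists2 y, y < c & (P ([set w | y < Y w]%R `\` [set w | c <= Y w]%R) <= e%:E)%E.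
Proof.
move=> e0; pose D n := [set w | c - n.+1%:R^-1 < Y w] `\` [set w | c <= Y w].
have mD n : measurable (D n).
  by apply: measurableD; [exact: measurable_lt_set|exact: measurable_le_set].
have cD : P (D n) @[n --> \oo] --> P (\bigcap_n D n).
  apply: nonincreasing_cvg_mu => //.
  - by rewrite -ge0_fin_numE// fin_num_measure.
  - exact: bigcap_measurable.
  - move=> n m nm; apply/subsetPset => t [/= cY Yc]; split=> //=; apply: le_lt_trans cY.
    by rewrite lerD2l lerN2 lef_pV2 ?posrE// ler_nat.
have D0 : \bigcap_n D n = set0.
  rewrite -subset0 => t Dt; have [_ /negP] := Dt 0 I; rewrite -ltNge => Yc.
  have /ltr_add_invr[n] : 0 < c - Y t by rewrite subr_gt0.
  rewrite add0r => nc; have [+ _] := Dt n I.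
  by rewrite /= ltrBlDr -ltrBlDl ltNge ltW.
rewrite D0 measure0 in cD.
have /cvgr_lt /(_ _ e0) [n _ /(_ n (leqnn n))/= Pn] : fine (P (D n)) @[n --> \oo] --> 0.
  exact: fine_cvg cD.
exists (c - n.+1%:R^-1); first by rewrite ltrBlDr ltrDl.
have fD : P (D n) \is a fin_num by rewrite fin_num_measure.
by rewrite -[leLHS](fineK fD) lee_fin ltW.
Qed.

(** The two conditional probabilities have the same law, so the convex order holds with equality.
    For [y < c] the event [c <= Y] lies inside [y < Y], which makes one of the differences empty;
    the other is small for [y] close to [c]. *)
Lemma ccx_le_of_cond_cdf d d' d1 d2 (T : measurableType d) (T' : measurableType d')
    (S : measurableType d1) (S' : measurableType d2) (R : realType)
    (P : probability T R) (Y : {RV P >-> R}) (X : {RV P >-> S})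
    (P' : probability T' R) (Y' : {RV P' >-> R}) (X' : {RV P' >-> S'})
    (H : R -> S -> R) (H' : R -> S' -> R) :
  (forall y, is_cond_prob P X [set w | Y w <= y] (H y)) ->
  (forall y, is_cond_prob P' X' [set w | Y' w <= y] (H' y)) ->
  (forall y w, P [set t | w <= H y (X t)] = P' [set t | w <= H' y (X' t)]) ->
  (forall v, quantile_of Y v = quantile_of Y' v) ->
  ccx_le Y X Y' X'.
Proof.
move=> hH hH' HH' qq v v01 g g' gE gE' phi cphi; rewrite -qq in gE'.
set c := quantile_of Y v in gE gE'.
have mX : measurable_fun setT X by exact: measurable_funP.
have mX' : measurable_fun setT X' by exact: measurable_funP.
have mE : measurable [set w | c <= Y w] by exact: measurable_le_set.
have mE' : measurable [set w | c <= Y' w] by exact: measurable_le_set.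
have mF y : measurable [set w | Y w <= y] by exact: measurable_le_set.
have mF' y : measurable [set w | Y' w <= y] by exact: measurable_le_set.
have hC y := is_cond_probC mX (mF y) (hH y).
have hC' y := is_cond_probC mX' (mF' y) (hH' y).
have mg := measurableT_comp (is_cond_prob_measurable gE) mX.
have mg' := measurableT_comp (is_cond_prob_measurable gE') mX'.
(* An upper ray for [1 - H y] is a lower ray for [H y], so equality of the whole laws is needed
   here. *)
have law y w : P [set t | w <= 1 - H y (X t)] = P' [set t | w <= 1 - H' y (X' t)].
  have mB : measurable [set x : R | w <= 1 - x].
    by apply: measurable_le_set => //; exact: measurable_funB.
  apply: (eq_rays_law _ _ (HH' y) mB).
    exact: measurableT_comp (is_cond_prob_measurable (hH y)) mX.
  exact: measurableT_comp (is_cond_prob_measurable (hH' y)) mX'.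
have CE d0 (T0 : measurableType d0) (Z : T0 -> R) y :
    ~` [set w | Z w <= y] = [set w | y < Z w].
  by apply/seteqP; split => w /=; rewrite ltNge => /negP.
have sub d0 (T0 : measurableType d0) (P0 : probability T0 R) (Z : T0 -> R) y e :
    0 < e -> y < c ->
    (P0 ([set w | (c <= Z w)%R] `\` [set w | (y < Z w)%R]) <= e%:E)%E.
  move=> e0 yc; rewrite (_ : _ `\` _ = set0) ?measure0 ?lee_fin ?ltW//.
  by rewrite -subset0 => w [/= cZ]; apply; exact: lt_le_trans cZ.
suff -> : ('E_P[phi \o (g \o X)] = 'E_P'[phi \o (g' \o X')])%E by [].
apply: eq_law_expectation => //; last exact: convex_function_measurable.
apply: eq_rays_law => // w; apply/eqP; rewrite eq_le; apply/andP; split.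
  apply: (is_cond_prob_approx_le mX mX' mE mE' gE gE') => e e0.
  have [y yc Py] := probability_left_approx Y' c e0.
  do 4 eexists; split; [| |exact: (hC y)|exact: (hC' y)|split; [exact: law|..]].
  - exact: measurableC.
  - exact: measurableC.
  - by rewrite CE; exact: sub.
  - by rewrite CE.
apply: (is_cond_prob_approx_le mX' mX mE' mE gE' gE) => e e0.
have [y yc Py] := probability_left_approx Y c e0.
do 4 eexists; split; [| |exact: (hC' y)|exact: (hC y)|split; [by move=> ?; rewrite law|..]].
- exact: measurableC.
- exact: measurableC.
- by rewrite CE; exact: sub.
- by rewrite CE.
Qed.

(** * The transform evaluated at independent uniform variables *)

(** The restriction to [A] is absorbed into the integrand of [ge0_integral_cond_cdf], set to 0 when
    its first argument leaves [A]. *)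
Lemma ge0_integral_cond_cdf_in d d' (T : measurableType d) (S : measurableType d')
    (R : realType) (P : probability T R) (Z : T -> S) (Y : T -> R)
    (G : S -> cumulativeBounded (0 : R) 1) (f : R -> \bar R) (A : set S) :
  measurable_fun [set: T] Z -> measurable_fun [set: T] Y ->
  is_cond_cdf P Z Y G ->
  measurable_fun [set: R] f -> (forall x, 0 <= f x)%E -> measurable A ->
  (\int[P]_(w in Z @^-1` A) f (Y w) =
   \int[P]_(w in Z @^-1` A) \int[uniform_prob (@ltr01 R)]_u f (quantile01 (G (Z w)) u))%E.
Proof.
move=> mZ mY hG mf f0 mA.
pose fA : S * R -> \bar R := (fun z => f z.2) \_ (A `*` setT).
have mfA : measurable_fun setT fA.
  apply/(measurable_restrictT (fun z : S * R => f z.2)); first exact: measurableX.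
  by apply: measurable_funTS; exact: (measurableT_comp mf measurable_snd).
have fA0 z : (0 <= fA z)%E by rewrite /fA patchE; case: ifPn.
rewrite integral_mkcond [RHS]integral_mkcond.
transitivity (\int[P]_w fA (Z w, Y w))%E.
  apply: eq_integral => w _; rewrite /fA !patchE; congr (if _ then _ else _).
  by apply/idP/idP; rewrite !inE//= => -[].
rewrite (ge0_integral_cond_cdf mZ mY hG mfA fA0).
apply: eq_integral => w _; rewrite patchE; case: ifPn => [|/negP] wA; rewrite ?inE in wA.
  by apply: eq_integral => u _; rewrite /fA patchE mem_set.
apply: integral0_eq => u _; rewrite /fA patchE memNset//.
by move=> [] /=.
Qed.

Lemma indep_joint_law d (T : measurableType d) (R : realType)
    (P : probability T R) (U V : {RV P >-> R}) : indep U V ->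
  forall X : set (R * R), measurable X ->
  (distribution P U \x distribution P V)%E X = P [set w | X (U w, V w)].
Proof.
move=> hUV.
have mUV : measurable_fun setT (fun w => (U w, V w)) by exact/measurable_fun_pairP.
pose UV : {mfun T >-> (R * R)%type} :=
  HB.pack (fun w => (U w, V w)) (isMeasurableFun.Build _ _ _ _ _ mUV).
apply: (@product_measure_unique _ _ _ _ _ _ _ (distribution P UV)) => A B mA mB.
exact: hUV.
Qed.

Lemma indep_uniform_cond_cdf d (T : measurableType d) (R : realType)
    (P : probability T R) (U V : {RV P >-> R}) (K : R -> cumulativeBounded (0 : R) 1) :
  is_uniform01 V -> indep U V ->
  (forall y, measurable_fun [set: R] (fun u => K u y)) ->
  is_cond_cdf P U (fun w => quantile01 (K (U w)) (V w)) K.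
Proof.
move=> hV hUV mK y.
have mU : measurable_fun setT U by exact: measurable_funP.
have mQ := measurable_quantile01 mK.
have K01 (u : R) : (0 <= (K u y)%:E)%E by rewrite lee_fin cumulativeBounded_ge0.
have mKU : measurable_fun [set: T] (fun w => (K (U w) y)%:E).
  by apply/measurable_EFinP; exact: (measurableT_comp (mK y)).
split.
- exact/measurable_EFinP.
- apply/integrableP; split => //.
  apply: (@le_lt_trans _ _ (\int[P]_w (cst 1%:E w))%E).
    apply: ge0_le_integral => //.
    + exact: measurableT_comp.
    + by move=> w _; rewrite gee0_abs//= lee_fin cumulativeBounded_le1.
  by rewrite integral_cst// mul1e (le_lt_trans (probability_le1 _ _))// ltry.
move=> A mA; have mUA := measurable_preimage mU mA.
have mW : measurable_fun setT (fun w => quantile01 (K (U w)) (V w)).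
  have mUV : measurable_fun setT (fun w => (U w, V w)) by exact/measurable_fun_pairP.
  exact: (measurableT_comp mQ mUV).
have mE : measurable [set w | quantile01 (K (U w)) (V w) <= y] by exact: measurable_le_set.
rewrite [RHS]integral_indic//.
pose B : set (R * R) := (A `*` setT) `&` [set z | quantile01 (K z.1) z.2 <= y].
have mB : measurable B.
  apply: measurableI; first by apply: measurableX.
  exact: measurable_le_set.
rewrite (_ : _ `&` _ = [set w | B (U w, V w)]); last first.
  by apply/seteqP; split=> w; [move=> [qy Aw]; split|move=> [[Aw _] qy]; split].
(* Independence makes the joint law a product, so [U] can be frozen at [u]: the section over [u] in
   [A] has mass [K u y] by [uniform01_quantile01]. *)
apply: etrans (indep_joint_law hUV mB); rewrite /product_measure1.
rewrite integral_mkcond.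
rewrite (eq_integral (((fun u => (K u y)%:E) \_ A) \o U)); last first.
  by move=> w _; rewrite /= !patchE; congr (if _ then _ else _).
rewrite -ge0_integral_distribution; last 2 first.
- apply/(measurable_restrictT (fun u : R => (K u y)%:E)) => //.
  by apply: measurable_funTS; apply/measurable_EFinP; exact: mK.
- by move=> u; rewrite patchE; case: ifPn.
apply: eq_integral => u _; rewrite patchE; case: ifPn => [|/negP] uA; rewrite ?inE in uA.
  rewrite /= (_ : xsection _ _ = [set t | quantile01 (K u) t <= y]); last first.
    by apply/seteqP; split => t; rewrite /xsection/= inE/=; [case|].
  rewrite -[LHS]uniform01_quantile01; apply/esym/hV.
  apply: measurable_le_set => //.
  exact: (measurableT_comp mQ (pair1_measurable u)).
rewrite /= (_ : xsection _ _ = set0); first by rewrite measure0.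
by rewrite -subset0 => t; rewrite /xsection/= inE/= => -[[]].
Qed.

Lemma uniform01_null d (T : measurableType d) (R : realType)
    (P : probability T R) (U : {RV P >-> R}) : is_uniform01 U ->
  P (U @^-1` (~` `]0, 1[)) = 0%E.
Proof.
move=> hU; rewrite -[LHS]/(distribution P U _) hU; last exact: measurableC.
by rewrite uniform01E ?setICl ?measure0//; exact: measurableC.
Qed.

(** Needed because [rearranged_quantile_transform] is 0 when [U] leaves (0,1), whereas [quantile01]
    only watches its second argument. *)
Lemma is_cond_cdf_ae d d' (T : measurableType d) (S : measurableType d')
    (R : realType) (P : probability T R) (Z : T -> S) (Y Y' : T -> R)
    (G : S -> cumulativeBounded (0 : R) 1) (N : set T) :
  measurable_fun [set: T] Z -> measurable_fun [set: T] Y -> measurable_fun [set: T] Y' ->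
  measurable N -> P N = 0%E -> (forall w, ~ N w -> Y w = Y' w) ->
  is_cond_cdf P Z Y G -> is_cond_cdf P Z Y' G.
Proof.
move=> mZ mY mY' mN PN YY' hG y; have [mG iG hA] := hG y; split => // A mA.
have mE : measurable [set w | Y w <= y] by exact: measurable_le_set.
have mE' : measurable [set w | Y' w <= y] by exact: measurable_le_set.
rewrite (hA A mA); apply: ae_eq_integral.
- exact: measurable_preimage.
- by apply/measurable_EFinP; apply: measurable_funTS; exact: measurable_indic.
- by apply/measurable_EFinP; apply: measurable_funTS; exact: measurable_indic.
exists N; split => // w /=; apply: contra_notP => /YY' Yw _.
by rewrite !indicE; congr (_%:R%:E); congr nat_of_bool; apply/idP/idP; rewrite !inE /= Yw.
Qed.

(** * Stochastic monotonicity of the transform *)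

Lemma quantile01_nondecreasing (R : realType) (G G' : cumulativeBounded (0 : R) 1) t :
  (forall y, G' y <= G y) -> quantile01 G t <= quantile01 G' t.
Proof.
move=> GG'; rewrite /quantile01; case: ifPn => // t01.
by rewrite quantile_le// (le_trans _ (GG' _))// -quantile_le.
Qed.

Lemma measurable_integral_quantile01 d (S : measurableType d) (R : realType)
    (K : S -> cumulativeBounded (0 : R) 1) (f : R -> \bar R) :
  (forall y, measurable_fun [set: S] (fun s => K s y)) ->
  measurable_fun [set: R] f -> (forall x, 0 <= f x)%E ->
  measurable_fun [set: S]
    (fun s => \int[uniform_prob (@ltr01 R)]_t f (quantile01 (K s) t))%E.
Proof.
move=> mK mf f0; pose h (z : S * measurableTypeR R) := f (quantile01 (K z.1) z.2).
have mh : measurable_fun setT h by exact: (measurableT_comp mf (measurable_quantile01 mK)).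
have h0 z : (0 <= h z)%E by exact: f0.
exact: (@measurable_fun_fubini_tonelli_F _ _ _ _ R (uniform_prob (@ltr01 R)) h mh h0).
Qed.

Lemma cond_cdf_stochastically_increasing d (T : measurableType d) (R : realType)
    (P : probability T R) (W U : {RV P >-> R}) (K : R -> cumulativeBounded (0 : R) 1) :
  is_uniform01 U -> is_cond_cdf P U W K ->
  (forall y, {in `]0, 1[ &, {homo (fun u => K u y) : s t / s <= t >-> t <= s}}) ->
  stochastically_increasing W U.
Proof.
move=> hU hK Kni f fnd fW; pose mu := uniform_prob (@ltr01 R).
have mK := is_cond_cdf_measurable hK.
have mU : measurable_fun setT U by exact: measurable_funP.
have mW : measurable_fun setT W by exact: measurable_funP.
have mf : measurable_fun [set: R] f by exact: nondecreasing_measurable.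
have mEf : measurable_fun [set: R] (EFin \o f) by exact/measurable_EFinP.
pose fp := ((EFin \o f)^\+)%E; pose fm := ((EFin \o f)^\-)%E.
have mfp : measurable_fun [set: R] fp by exact: measurable_funepos.
have mfm : measurable_fun [set: R] fm by exact: measurable_funeneg.
have fp0 x : (0 <= fp x)%E by exact: funepos_ge0.
have fm0 x : (0 <= fm x)%E by exact: funeneg_ge0.
have fpnd x y : x <= y -> (fp x <= fp y)%E.
  by move=> xy; rewrite /fp !funeposE; apply: le_max2; rewrite ?lee_fin// fnd.
have fmni x y : x <= y -> (fm y <= fm x)%E.
  by move=> xy; rewrite /fm !funenegE; apply: le_max2; rewrite ?leeN2 ?lee_fin// fnd.
pose q u t := quantile01 (K u) t.
pose gp u := (\int[mu]_t fp (q u t))%E; pose gm u := (\int[mu]_t fm (q u t))%E.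
have mgp : measurable_fun [set: R] gp by exact: measurable_integral_quantile01.
have mgm : measurable_fun [set: R] gm by exact: measurable_integral_quantile01.
have gp0 u : (0 <= gp u)%E by exact: integral_ge0.
have gm0 u : (0 <= gm u)%E by exact: integral_ge0.
have mq u : measurable_fun [set: R] (q u).
  exact: (measurableT_comp (measurable_quantile01 mK) (pair1_measurable u)).
have qnd u v t : u \in `]0, 1[ -> v \in `]0, 1[ -> u <= v -> q u t <= q v t.
  by move=> u01 v01 uv; apply: quantile01_nondecreasing => y; exact: Kni.
have gpnd u v : u \in `]0, 1[ -> v \in `]0, 1[ -> u <= v -> (gp u <= gp v)%E.
  move=> u01 v01 uv; apply: ge0_le_integral => //.
  - exact: (measurableT_comp mfp (mq u)).
  - exact: (measurableT_comp mfp (mq v)).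
  - by move=> t _; apply: fpnd; exact: qnd.
have gmni u v : u \in `]0, 1[ -> v \in `]0, 1[ -> u <= v -> (gm v <= gm u)%E.
  move=> u01 v01 uv; apply: ge0_le_integral => //.
  - exact: (measurableT_comp mfm (mq v)).
  - exact: (measurableT_comp mfm (mq u)).
  - by move=> t _; apply: fmni; exact: qnd.
have Ip A : measurable A ->
    (\int[P]_(w in U @^-1` A) gp (U w) = \int[P]_(w in U @^-1` A) fp (W w))%E.
  by move=> mA; rewrite (ge0_integral_cond_cdf_in mU mW hK mfp fp0 mA).
have Im A : measurable A ->
    (\int[P]_(w in U @^-1` A) gm (U w) = \int[P]_(w in U @^-1` A) fm (W w))%E.
  by move=> mA; rewrite (ge0_integral_cond_cdf_in mU mW hK mfm fm0 mA).
have mgpU : measurable_fun setT (gp \o U) by exact: measurableT_comp.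
have mgmU : measurable_fun setT (gm \o U) by exact: measurableT_comp.
have Efp : ((EFin \o (f \o W))^\+ = fp \o W)%E by exact: (funepos_comp (EFin \o f) W).
have Efm : ((EFin \o (f \o W))^\- = fm \o W)%E by exact: (funeneg_comp (EFin \o f) W).
have igp : P.-integrable setT (gp \o U).
  apply/integrableP; split => //; under eq_integral do rewrite gee0_abs ?gp0//.
  have := integrable_funepos measurableT fW; rewrite Efp => /integrableP[_].
  under eq_integral do rewrite gee0_abs ?fp0//.
  by rewrite -[X in (\int[_]_(_ in X) _)%E](preimage_setT U) -Ip.
have igm : P.-integrable setT (gm \o U).
  apply/integrableP; split => //; under eq_integral do rewrite gee0_abs ?gm0//.
  have := integrable_funeneg measurableT fW; rewrite Efm => /integrableP[_].
  under eq_integral do rewrite gee0_abs ?fm0//.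
  by rewrite -[X in (\int[_]_(_ in X) _)%E](preimage_setT U) -Im.
have Pitv a b : 0 <= a -> a < b -> b <= 1 -> (0 < P (U @^-1` `]a, b[))%E.
  move=> a0 ab b1; rewrite -[ltRHS]/(distribution P U _) hU// uniform01_itv// ?ltW//.
  by rewrite lte_fin subr_gt0.
(* An infinite value at [a] would persist on (a,1) by monotonicity, an event of positive probability
   for [U], against the integrability of [gp (U w)]. *)
have gpfin a : a \in `]0, 1[ -> gp a \is a fin_num.
  move=> a01; rewrite ge0_fin_numE// ltey; apply/eqP => gpa.
  have /integrableP[_] := igp; apply/negP; rewrite -leNgt.
  have a0 : 0 <= a by move: a01; rewrite in_itv/= => /andP[/ltW].
  have a1 : a < 1 by move: a01; rewrite in_itv/= => /andP[].
  rewrite -(gt0_mulye (Pitv a 1 a0 a1 (lexx _))) -integral_cst; last exact: measurable_preimage.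
  apply: (@le_trans _ _ (\int[P]_(w in U @^-1` `]a, 1%R[) `|(gp \o U) w|)%E); last first.
    apply: ge0_subset_integral => //; last exact: measurableT_comp.
    exact: measurable_preimage.
  apply: ge0_le_integral => //.
  - exact: measurable_preimage.
  - by move=> w _; rewrite leey.
  - by apply: measurable_funTS; exact: measurableT_comp.
  - move=> w /=; rewrite in_itv/= => /andP[aw w1]; rewrite gee0_abs// -gpa.
    by apply: gpnd => //; [rewrite in_itv/= w1 (le_lt_trans a0)|exact: ltW].
(* The same argument to the left of [a], since [gm] decreases. *)
have gmfin a : a \in `]0, 1[ -> gm a \is a fin_num.
  move=> a01; rewrite ge0_fin_numE// ltey; apply/eqP => gma.
  have /integrableP[_] := igm; apply/negP; rewrite -leNgt.
  have a0 : 0 < a by move: a01; rewrite in_itv/= => /andP[].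
  have a1 : a <= 1 by move: a01; rewrite in_itv/= => /andP[_ /ltW].
  rewrite -(gt0_mulye (Pitv 0 a (lexx _) a0 a1)) -integral_cst; last exact: measurable_preimage.
  apply: (@le_trans _ _ (\int[P]_(w in U @^-1` `]0%R, a[) `|(gm \o U) w|)%E); last first.
    apply: ge0_subset_integral => //; last exact: measurableT_comp.
    exact: measurable_preimage.
  apply: ge0_le_integral => //.
  - exact: measurable_preimage.
  - by move=> w _; rewrite leey.
  - by apply: measurable_funTS; exact: measurableT_comp.
  - move=> w /=; rewrite in_itv/= => /andP[w0 wa]; rewrite gee0_abs// -gma.
    by apply: gmni => //; [rewrite in_itv/= w0 (lt_le_trans wa)|exact: ltW].
(* The infinite values outside (0,1) make [g] monotone on the whole line; [U] meets them with
   probability 0. *)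
pose g u := if u <= 0 then -oo%E else if 1 <= u then +oo%E else (gp u - gm u)%E.
have in01 (u : R) : ~~ (u <= 0) -> ~~ (1 <= u) -> u \in `]0, 1[.
  by rewrite -!ltNge in_itv/= => u0 u1; rewrite u0 u1.
have mg : measurable_fun [set: R] g.
  apply: measurable_fun_ifT => //; first exact: measurable_fun_ler.
  apply: measurable_fun_ifT => //; first exact: measurable_fun_ler.
  exact: emeasurable_funB.
have mgU : measurable_fun setT (g \o U) by exact: measurableT_comp.
have gU A : measurable A -> ae_eq P A (g \o U) ((gp \o U) \- (gm \o U))%E.
  move=> mA; exists (U @^-1` (~` `]0, 1[)); split.
  - by apply: measurable_preimage => //; exact: measurableC.
  - exact: uniform01_null.
  - move=> w /=; apply: contra_notP => /contrapT; rewrite in_itv/= => /andP[u0 u1] _.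
    by rewrite /g leNgt u0/= leNgt u1.
exists g.
  move=> u v uv; rewrite /g.
  have [v0|v0] := ifPn (v <= 0); first by rewrite (le_trans uv v0).
  case: ifPn => u0; first exact: leNye.
  case: ifPn => u1; first by rewrite (le_trans u1 uv).
  case: ifPn => v1; first exact: leey.
  by apply: leeB; [apply: gpnd|apply: gmni] => //; exact: in01.
split => //.
  apply/integrableP; split => //.
  rewrite (ae_eq_integral (fun w => `|((gp \o U) \- (gm \o U)) w|)%E)//.
  - by have /integrableP[] := integrableB measurableT igp igm.
  - exact: measurableT_comp.
  - by apply: measurableT_comp => //; exact: emeasurable_funB.
  - by apply: filterS (gU _ measurableT) => w + _; move=> ->.
move=> A mA; have mUA := measurable_preimage mU mA.
rewrite (ae_eq_integral ((gp \o U) \- (gm \o U))%E); last 4 first.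
- exact: mUA.
- exact: measurable_funTS.
- by apply: measurable_funTS; exact: emeasurable_funB.
- exact: gU.
rewrite integralB//; [|exact: integrableS igp|exact: integrableS igm].
rewrite [X in (X - _)%E](Ip A mA) [X in (_ - X)%E](Im A mA).
by rewrite [RHS]integralE Efp Efm.
Qed.

(** * Equality in distribution and conclusion *)

Lemma cond_prob_eq_probability d d' d1 d2 (T : measurableType d)
    (T' : measurableType d') (S : measurableType d1) (S' : measurableType d2)
    (R : realType) (P : probability T R) (X : T -> S) (P' : probability T' R)
    (X' : T' -> S') (E : set T) (E' : set T') (h : S -> R) (h' : S' -> R) :
  measurable_fun [set: T] X -> measurable_fun [set: T'] X' ->
  measurable E -> measurable E' ->
  is_cond_prob P X E h -> is_cond_prob P' X' E' h' ->
  (forall w, P [set t | w <= h (X t)] = P' [set t | w <= h' (X' t)]) ->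
  P E = P' E'.
Proof.
move=> mX mX' mE mE' hE hE' hh'.
have mh := measurableT_comp (is_cond_prob_measurable hE) mX.
have mh' := measurableT_comp (is_cond_prob_measurable hE') mX'.
have := eq_law_expectation mh mh' (eq_rays_law mh mh' hh') (@measurable_id _ _ setT).
have := is_cond_probE mX mE hE measurableT.
have := is_cond_probE mX' mE' hE' measurableT.
rewrite !preimage_setT !setIT => <- <-.
by rewrite unlock.
Qed.

(** Reflection at 0 turns the lower rays of distribution functions into the upper rays of
    [eq_rays_law]. *)
Lemma eq_cdf_law d d' (T : measurableType d) (T' : measurableType d')
    (R : realType) (P : probability T R) (P' : probability T' R)
    (Y : {RV P >-> R}) (Y' : {RV P' >-> R}) :
  (forall y, P [set t | Y t <= y] = P' [set t | Y' t <= y]) -> eq_dist Y Y'.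
Proof.
move=> YY' B mB.
have mN d0 (T0 : measurableType d0) (Z : T0 -> R) : measurable_fun setT Z ->
    measurable_fun setT (fun t => - Z t) by move=> mZ; exact: measurable_funN.
have mY : measurable_fun setT Y by exact: measurable_funP.
have mY' : measurable_fun setT Y' by exact: measurable_funP.
have NE d0 (T0 : measurableType d0) (Z : T0 -> R) w :
    [set t | w <= - Z t] = [set t | Z t <= - w].
  by apply/seteqP; split => t /=; rewrite lerNr.
have := @eq_rays_law _ _ _ _ _ P P' _ _ (mN _ _ _ mY) (mN _ _ _ mY').
have mNB : measurable ((fun x : R => - x) @^-1` B).
  by apply: measurable_preimage => //; exact: mN.
move=> /(_ _ _ mNB); rewrite /distribution /pushforward.
have NN d0 (T0 : measurableType d0) (Z : T0 -> R) :
    (fun t => - Z t) @^-1` ((fun x => - x) @^-1` B) = Z @^-1` B.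
  by apply/seteqP; split => t /=; rewrite opprK.
by rewrite !NN; apply => w; rewrite !NE.
Qed.

Theorem theorem2p7 (R : realType) (p : nat) (hp : (0 < p)%N)
    (d : measure_display) (T : measurableType d) (P : probability T R)
    (Y : {RV P >-> R}) (X : {RV P >-> p.-tuple R})
    (* conditional distribution functions of X_i given X_0, ..., X_(i-1) *)
    (G : forall i : nat, i.-tuple R -> cumulativeBounded (0 : R) 1)
    (hG : is_cond_cdf_family P X G)
    (* H y x is P(Y <= y | X = x) *)
    (H : R -> p.-tuple R -> R)
    (hH : forall y : R, is_cond_prob P X [set w | Y w <= y] (H y))
    (* F u y is F_u(y) *)
    (F : R -> cumulativeBounded (0 : R) 1)
    (hF : forall y : R,
       is_decreasing_rearrangement
         (fun u : p.-tuple R => H y (quantile_transform G u))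
         (fun u : R => F u y))
    (d' : measure_display) (T' : measurableType d') (P' : probability T' R)
    (U V : {RV P' >-> R})
    (hU : is_uniform01 U) (hV : is_uniform01 V) (hUV : indep U V) :
  exists W : {RV P' >-> R},
    [/\ forall w, W w = rearranged_quantile_transform F (U w) (V w),
        eq_dist W Y,
        stochastically_increasing W U &
        ccx_eq W U Y X].
Proof.
have mU : measurable_fun setT U by exact: measurable_funP.
have mV : measurable_fun setT V by exact: measurable_funP.
have mX : measurable_fun setT X by exact: measurable_funP.
(* [hF] constrains [F u] only for [u] in (0,1); freezing the value elsewhere at an interior point
   makes [K] measurable on the whole line. *)
pose K u := if 0 < u < 1 then F u else F 2^-1.
have K01 u : 0 < u < 1 -> K u = F u by rewrite /K => ->.
have Kni y : {in `]0, 1[ &, {homo (fun u => K u y) : s t / s <= t >-> t <= s}}.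
  move=> s t s01 t01 st; rewrite in_itv/= in s01; rewrite in_itv/= in t01.
  by rewrite !K01//; apply: (hF y).1; rewrite ?in_itv.
have m01 : measurable_fun [set: R] (fun u : R => 0 < u < 1).
  by apply: measurable_and => //; exact: measurable_fun_ltr.
have mK y : measurable_fun [set: R] (fun u => K u y).
  apply: (measurability (@RGenCInfty.G R)) => [|/= _ [_] [w] -> <-].
    exact: RGenCInfty.measurableE.
  rewrite setTI (_ : _ @^-1` _ = (`]0, 1[ `&` [set u | w <= F u y]) `|`
      (~` `]0, 1[ `&` [set u : R | w <= F 2^-1 y])); last first.
    apply/seteqP; split => u /=; rewrite /K !in_itv/= andbT.
      by case: ifPn => [u01|/negP u01]; [left|right].
    by case=> -[u01 wF]; [rewrite u01|move/negP/negbTE: u01 => ->].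
  apply: measurableU.
    apply: is_interval_measurable => s t /= [s01 ws] [t01 wt] u /andP[su ut].
    (* Monotonicity makes the superlevel sets of [F u y] in (0,1) intervals. *)
    have u01 : u \in `]0, 1[.
      move: s01 t01; rewrite !in_itv/= => /andP[s0 _] /andP[_ t1].
      by rewrite (lt_le_trans s0)// (le_lt_trans ut).
    by split => //; rewrite (le_trans wt)//; exact: (hF y).1.
  apply: measurableI; first exact: measurableC.
  exact: measurable_le_set.
have law y w : P' [set t | w <= K (U t) y] = P [set t | w <= H y (X t)].
  have mB : measurable [set u : R | w <= K u y] by exact: measurable_le_set.
  rewrite -[LHS]/(distribution P' U [set u | w <= K u y]) hU// uniform01E//.
  rewrite (_ : _ `&` _ = [set s | 0 < s < 1 /\ w <= F s y]); last first.
    apply/seteqP; split => u /=; rewrite in_itv/=.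
      by move=> [+ u01]; rewrite K01.
    by move=> [u01 wF]; rewrite K01.
  rewrite (hF y).2.
  (* The rearrangement has moved the uniform mass to the unit cube, where the quantile transform
     produces the law of [X]. *)
  apply: (quantile_transform_law hG (B := [set x | w <= H y x])).
  by apply: measurable_le_set => //; exact: is_cond_prob_measurable (hH y).
pose W0 t := quantile01 (K (U t)) (V t).
pose W t := rearranged_quantile_transform F (U t) (V t).
have mW0 : measurable_fun setT W0.
  have mUV : measurable_fun setT (fun w => (U w, V w)) by exact/measurable_fun_pairP.
  exact: (measurableT_comp (measurable_quantile01 mK) mUV).
(* Both variables are 0 when [V] leaves (0,1), so they can differ only when [U] does. *)
have WE t : W t = if 0 < U t < 1 then W0 t else 0.
  rewrite /W /W0 /rearranged_quantile_transform /quantile01.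
  case: ifPn => [/andP[u01 v01]|]; first by rewrite u01 v01 K01.
  by case: ifPn => //= _ /negbTE ->.
have mW : measurable_fun setT W.
  rewrite (_ : W = fun t => if 0 < U t < 1 then W0 t else 0); last exact/funext.
  by apply: measurable_fun_ifT => //; exact: (measurableT_comp m01).
pose w : {RV P' >-> R} := HB.pack W (isMeasurableFun.Build _ _ _ _ _ mW).
have hW : is_cond_cdf P' U w K.
  apply: (is_cond_cdf_ae mU mW0 mW _ (uniform01_null hU)) => [|t /contrapT|].
  - by apply: measurable_preimage => //; exact: measurableC.
  - by rewrite /= in_itv/= WE => ->.
  - exact: indep_uniform_cond_cdf.
have wY : eq_dist w Y.
  apply: eq_cdf_law => y.
  apply: (cond_prob_eq_probability mU mX _ _ (hW y) (hH y) (law y)).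
    exact: measurable_le_set.
  exact: measurable_le_set.
have qq v : quantile_of w v = quantile_of Y v.
  rewrite /quantile_of; congr quantile; apply/funext => y.
  by congr fine; exact: wY.
exists w; split => //.
- exact: cond_cdf_stochastically_increasing hU hW Kni.
- split.
    exact: (ccx_le_of_cond_cdf hW hH law qq).
  by apply: (ccx_le_of_cond_cdf hH hW).
Qed.
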